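(* Let $T$ be an infinite, locally finite tree rooted at $o$ and having no leaves except possibly $o$. Suppose that $J_v\equiv J>0$ is constant, let $\beta>0$, and let $\theta:=\tanh(\beta J)$. Then phase transition occurs with plus boundary conditions, i.e. $\lim_{N\to\infty}\mathbf P^{(N,+)}(\eta(o)=+1)>1/2$, if and only if $\mathrm{cap}_3(T)>0$, where the edge between a vertex at distance $n$ from the root and its parent has resistance $\theta^{-n}$. If $T$ is spherically symmetric (the number of children of a vertex $v$ depends only on $|v|$), this is equivalent to $$\sum_{n\ge1}\theta^{-2n}|T_n|^{-2}<\infty .$$
   Context: $|v|$ is the distance from $o$ to $v$, $T_n=\{v:|v|=n\}$, and $v\to w$ means $v$ is the parent of $w$ (the neighbor of $w$ closer to $o$). Plus boundary conditions: $T^{(N)}$ is the subtree induced on $\{v:|v|\le N\}$. $\mathbf P^{(N,+)}$ is the probability measure on the set of configurations $\eta:V(T^{(N)})\to\{\pm1\}$ with $\eta(v)=+1$ for all $|v|=N$, with $\mathbf P^{(N,+)}(\eta)$ proportional to $\prod_{v\to w}\exp(\beta J\eta(v)\eta(w))$ (product over edges of $T^{(N)}$). The probabilities $\mathbf P^{(N,+)}(\eta(o)=+1)$ decrease in $N$. Capacity: $\partial T$ is the set of maximal (here infinite) paths from $o$ directed away from the root. A flow $\mu$ is a nonnegative function on edges with $\mu(vw)=\sum_{y:w\to y}\mu(wy)$ whenever $v\to w$ and $w$ is not a leaf; $|\mu|=\sum_{y:o\to y}\mu(oy)$. For $p>1$, $s=p-1$ and resistances $R(e)$, set $V_\mu(y)=\sum_{e\in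 y}(\mu(e)R(e))^s$ for $y\in\partial T$, $V(\mu)=\sup_{y\in\partial T}V_\mu(y)$, and $\mathrm{cap}_p(T)=\sup\{|\mu| : \mu \text{ a flow on } T \text{ with } V(\mu)=1\}$ (equal to $0$ if there is no such flow). *)

(* Defs.v *)
From HB Require Import structures.
From mathcomp Require Import all_boot all_order all_algebra finmap.
From mathcomp Require Import all_classical all_reals all_analysis.

Set Implicit Arguments.
Unset Strict Implicit.
Unset Printing Implicit Defensive.
Import Order.TTheory GRing.Theory Num.Theory.
Import numFieldNormedType.Exports.
Local Open Scope classical_set_scope.
Local Open Scope ring_scope.

Record tree (V : choiceType) := Tree {
  adj : rel V;
  adj_sym : symmetric adj;
  adj_irr : irreflexive adj;
  adj_path : forall x y : V,
    exists! p : seq V, [/\ path adj x p, last x p = y & uniq (x :: p)] }.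

Section Trees.
Context (V : choiceType) (T : tree V).

Definition walk_of_length (x y : V) (n : nat) : bool :=
  `[< exists p : seq V, [/\ path (adj T) x p, last x p = y & size p = n] >].

Lemma ex_walk (x y : V) : exists n, walk_of_length x y n.
Proof.
have [p [[xp py _] _]] := adj_path T x y.
by exists (size p); apply/asboolP; exists p.
Qed.

Definition dist (x y : V) : nat := ex_minn (ex_walk x y).

Definition neighbors (v : V) : set V := [set w | adj T v w].

Definition locally_finite : Prop := forall v, finite_set (neighbors v).

Definition leaf (v : V) : Prop := exists u, neighbors v = [set u].

Definition parent (o v w : V) : bool := adj T v w && (dist o v < dist o w)%N.

Definition children (o v : V) : set V := [set w | parent o v w].

Definition level (o : V) (n : nat) : set V := [set v | dist o v = n].

(* [fset_set A] is the finite set with the elements of [A] when [A] is finite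
   (and empty otherwise); the sets below are finite in a locally finite tree. *)
Definition ball (o : V) (n : nat) : {fset V} :=
  fset_set [set v | (dist o v <= n)%N].

Definition level_size (o : V) (n : nat) : nat := #|` fset_set (level o n)|.

Definition spherically_symmetric (o : V) : Prop :=
  forall v w, dist o v = dist o w ->
    #|` fset_set (children o v)| = #|` fset_set (children o w)|.

(* A maximal path from [o] directed away from [o], in the case where all such
   paths are infinite. *)
Definition boundary (o : V) : set (nat -> V) :=
  [set y | y 0%N = o /\ forall n, parent o (y n) (y n.+1)].

End Trees.

Definition tanh {R : realType} (x : R) : R :=
  (expR x - expR (- x)) / (expR x + expR (- x)).

Section Ising.
Context (R : realType) (V : choiceType) (T : tree V) (o : V) (J beta : R).

(* [true] is the spin +1 and [false] the spin -1. *)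
Definition config (N : nat) : finType := {ffun ball T o N -> bool}.

Definition spin (b : bool) : R := if b then 1 else -1.

Definition plus_configs (N : nat) : {set config N} :=
  [set eta : config N |
    [forall v : ball T o N, (dist T o (val v) == N) ==> eta v]]%SET.

Definition weight (N : nat) (eta : config N) : R :=
  \prod_(e : ball T o N * ball T o N | parent T o (val e.1) (val e.2))
    expR (beta * J * spin (eta e.1) * spin (eta e.2)).

Definition plus_measure (N : nat) (A : {set config N}) : R :=
  (\sum_(eta in (A :&: plus_configs N)%SET) weight eta) /
  (\sum_(eta in plus_configs N) weight eta).

Definition root_plus (N : nat) : {set config N} :=
  [set eta : config N |
    [exists v : ball T o N, (val v == o) && eta v]]%SET.

Definition phase_transition_plus : Prop :=
  1 / 2 < limn (fun N : nat => plus_measure (root_plus N)).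

End Ising.

Section Capacity.
Context (R : realType) (V : choiceType) (T : tree V) (o : V).

(* A function [f] on edges is represented by [f v w] for [v] the parent of [w];
   its values at other pairs are irrelevant. *)
Definition flow (mu : V -> V -> R) : Prop :=
  (forall v w, parent T o v w -> 0 <= mu v w) /\
  (forall v w, parent T o v w -> ~ leaf T w ->
     mu v w = \sum_(y \in children T o w) mu w y).

Definition strength (mu : V -> V -> R) : R :=
  \sum_(y \in children T o o) mu o y.

Definition path_potential (res : V -> V -> R) (s : R) (mu : V -> V -> R)
    (y : nat -> V) : \bar R :=
  (\sum_(0 <= n <oo) ((mu (y n) (y n.+1) * res (y n) (y n.+1)) `^ s)%:E)%E.

Definition potential (res : V -> V -> R) (s : R) (mu : V -> V -> R) : \bar R :=
  ereal_sup [set path_potential res s mu y | y in boundary T o].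

Definition cap (p : R) (res : V -> V -> R) : \bar R :=
  let S := [set (strength mu)%:E | mu in
             [set mu | flow mu /\ potential res (p - 1) mu = 1%E]] in
  if S == set0 then 0%E else ereal_sup S.

End Capacity.

(* Main.v *)
Require Import Defs.
From HB Require Import structures.
From mathcomp Require Import all_boot all_order all_algebra finmap.
From mathcomp Require Import all_classical all_reals all_analysis.
From mathcomp Require Import ring lra.

Set Implicit Arguments.
Unset Strict Implicit.
Unset Printing Implicit Defensive.
Import Order.TTheory GRing.Theory Num.Theory.
Import numFieldNormedType.Exports.
Local Open Scope classical_set_scope.
Local Open Scope ring_scope.

(* Let x(v) be the log-likelihood ratio of the spin at v in the subtree below v.
   Then x(v) is the sum of f(x(w)) over the children w of v, where
   f(x) = 2 artanh(theta tanh(x/2)); at level N, x = +oo and f(x) = 2 beta J.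
   The cubic term of the odd function f makes it comparable, on the whole
   of [0, +oo), to theta x / sqrt(1 + k x^2), for a small k from above and for a
   large k from below; this is what brings in the exponent s = 2, that is p = 3.

   If x(o) > 0 in the infinite volume limit, pushing mass x(o) down the tree
   proportionally to the messages f(x(w)) gives a flow; with
   a(v) the product over the vertices u of (o, v] of f(x(u)) / (theta x(u)), the
   upper bound on f says that k times the scaled squared flow through the edge
   ending at v is at most a(parent v)^2 - a(v)^2, so the potential is at most 1/k.
   Conversely, for a flow with normalized values m(v) and potential at most B, the
   lower bound on f propagates the estimate
   f(x(v)) >= theta m(v) / sqrt(k (B + 1 - energy of the path to the parent of v))
   from the leaves to the root, uniformly in the volume.

   On a spherically symmetric tree the flow built from x is radial, so it has the
   same potential, up to the square of its strength, as the uniform flow, and that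
   potential is the stated series. *)

(** * The message function *)

(** Mean value theorem for [g - f]. The derivatives are compared only inside the interval, so bounds
    valid merely for small arguments can be used. *)
Lemma le_of_derive (R : realType) (f g df dg : R -> R) (x : R) :
  (forall u : R, is_derive u 1 f (df u)) ->
  (forall u : R, is_derive u 1 g (dg u)) ->
  f 0 = g 0 -> 0 <= x -> (forall u, 0 < u < x -> df u <= dg u) -> f x <= g x.
Proof.
move=> fD gD fg0 x0 le_d; rewrite -subr_ge0.
have hD (u : R) : is_derive u 1 (g - f) (dg u - df u) by exact: is_deriveB.
move: x0; rewrite le_eqVlt => /predU1P[<-|x0]; first by rewrite fg0 subrr.
have cont : {within `[0, x], continuous (g - f)}.
  apply: continuous_subspaceT => u.
  by apply/differentiable_continuous/derivable1_diffP; have [] := hD u.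
have [c cx] := MVT x0 (fun u _ => hD u) cont.
have E u : (g - f) u = g u - f u by [].
rewrite !E fg0 subrr !subr0 => ->; apply: mulr_ge0; last exact: ltW.
by rewrite subr_ge0; apply: le_d; move: cx; rewrite in_itv.
Qed.

Section Message.
Context (R : realType) (A : R).
Hypothesis A_gt1 : 1 < A.

(* The log-likelihood ratio passed from a child with log-likelihood ratio [x]:
   [message x = 2 artanh (tanh (beta J) * tanh (x / 2))] for [A = e^(2 beta J)]. *)
Definition message (x : R) : R := ln (A * expR x + 1) - ln (expR x + A).

Let theta : R := (A - 1) / (A + 1).

(** This is [2 cosh x - 2], through which alone [x] enters the derivative of [message]. *)
Let excess (x : R) : R := expR x + expR (- x) - 2.

Let excessE (x : R) : excess x = (expR (x / 2) - expR (- (x / 2))) ^+ 2.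
Proof.
have e1 : expR (x / 2) * expR (- (x / 2)) = 1 by rewrite expRxMexpNx_1.
have e2 : expR x = expR (x / 2) ^+ 2 by rewrite -expRM_natr; congr expR; field.
have e3 : expR (- x) = expR (- (x / 2)) ^+ 2.
  by rewrite -expRM_natr; congr expR; field.
by rewrite /excess e2 e3 sqrrB e1; ring.
Qed.

(* The duplication formula upgrades the quadratic lower bound on [excess] to a
   quartic one. *)
Let excess_double (x : R) : excess x = excess (x / 2) ^+ 2 + 4 * excess (x / 2).
Proof.
have e1 : expR (x / 2) * expR (- (x / 2)) = 1 by rewrite expRxMexpNx_1.
have e2 : expR x = expR (x / 2) ^+ 2 by rewrite -expRM_natr; congr expR; field.
have e3 : expR (- x) = expR (- (x / 2)) ^+ 2.
  by rewrite -expRM_natr; congr expR; field.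
rewrite /excess e2 e3; set a := expR _ in e1 *; set b := expR _ in e1 *.
by transitivity (a ^+ 2 + b ^+ 2 + 2 * (a * b) - 4); [rewrite e1; ring|ring].
Qed.

Let sinh_ge (x : R) : 0 <= x -> 2 * x <= expR x - expR (- x).
Proof.
move=> x0.
apply: (@le_of_derive R (fun u : R => 2 * u) (fun u : R => expR u - expR (- u))
    (fun=> 2) (fun u : R => expR u + expR (- u))) => //.
- by move=> u; apply: is_derive_eq; rewrite /GRing.scale /= mulr1.
- move=> u; apply: is_derive_eq.
  by rewrite /GRing.scale /= mulrN1 opprK.
- by rewrite oppr0 subrr mulr0.
- by move=> u _; have := sqr_ge0 (expR (u / 2) - expR (- (u / 2)));
    rewrite -excessE /excess; lra.
Qed.

Let excess_ge0 (x : R) : 0 <= excess x.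
Proof. by rewrite excessE sqr_ge0. Qed.

Let excess_ge_sqr (x : R) : 0 <= x -> x ^+ 2 <= excess x.
Proof.
move=> x0; rewrite excessE; have := @sinh_ge (x / 2); nra.
Qed.

Let excess_ge (x : R) : 0 <= x -> x ^+ 2 + x ^+ 4 / 16 <= excess x.
Proof.
move=> x0; rewrite excess_double.
have h := @excess_ge_sqr (x / 2); set y := excess _ in h *.
have {}h : (x / 2) ^+ 2 <= y by apply: h; lra.
have h2 : ((x / 2) ^+ 2) ^+ 2 <= y ^+ 2.
  by rewrite ler_sqr ?nnegrE ?sqr_ge0 ?(le_trans (sqr_ge0 _) h).
nra.
Qed.

(** The excess is [e^x (1 - e^(-x))^2], and [1 - e^(-x) <= x]. This is the origin of the summand
    [c * expR 1] of [k] in [message_lower]. *)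
Let excess_le (x : R) : 0 <= x <= 1 -> excess x <= expR 1 * x ^+ 2.
Proof.
move=> /andP[x0 x1]; rewrite excessE.
have -> : expR (x / 2) - expR (- (x / 2)) = expR (x / 2) * (1 - expR (- x)).
  by rewrite mulrBr mulr1 -expRD; congr (_ - expR _); field.
rewrite exprMn -expRM_natr divfK ?pnatr_eq0// ler_pM ?expR_ge0 ?sqr_ge0//.
  by rewrite ler_expR.
have := expR_ge1Dx (- x); have : expR (- x) <= 1 by rewrite expR_le1; lra.
set a := expR _; nra.
Qed.

(** Equal to [(1 - theta^2) / 4]. *)
Let c : R := A / (A + 1) ^+ 2.

Let A1_neq0 : A + 1 != 0.
Proof. by have := A_gt1; lra. Qed.

Let is_derive_message (x : R) :
  is_derive x 1 message (theta / (1 + c * excess x)).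
Proof.
have a1 := A_gt1; have e0 := expR_gt0 x.
have p1 : 0 < A * expR x + 1 by nra.
have p2 : 0 < expR x + A by lra.
have d1 : is_derive x 1 (fun u : R => A * expR u + 1) (A * expR x).
  by apply: is_derive_eq; rewrite addr0.
have d2 : is_derive x 1 (fun u : R => expR u + A) (expR x).
  by apply: is_derive_eq; rewrite addr0.
have e1 := @is_derive1_comp R (@ln R) (fun u : R => A * expR u + 1) x _ _
  (is_derive1_ln p1) d1.
have e2 := @is_derive1_comp R (@ln R) (fun u : R => expR u + A) x _ _
  (is_derive1_ln p2) d2.
have -> : message = (@ln R \o (fun u : R => A * expR u + 1)) -
    (@ln R \o (fun u : R => expR u + A)).
  by apply/funext.
apply: is_derive_eq.
rewrite /theta /c /excess expRN; set e := expR x in e0 p1 p2 *.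
have q : (A + 1) ^+ 2 + A * (e + e^-1 - 2) != 0.
  have ei : 0 < e^-1 by rewrite invr_gt0.
  by rewrite gt_eqF//; nra.
field; rewrite ?A1_neq0 ?(gt_eqF e0) ?(gt_eqF p1) ?(gt_eqF p2) //=.
by rewrite gt_eqF//; nra.
Qed.

Let c_gt0 : 0 < c.
Proof. by have a1 := A_gt1; rewrite divr_gt0// ?exprn_gt0//; lra. Qed.

Let c_le1 : c <= 1.
Proof.
have a1 := A_gt1; rewrite ler_pdivrMr ?exprn_gt0//; [nra|lra].
Qed.

Let theta_gt0 : 0 < theta.
Proof. by have a1 := A_gt1; rewrite divr_gt0//; lra. Qed.

Lemma message0 : message 0 = 0.
Proof. by rewrite /message expR0 mulr1 [1 + A]addrC subrr. Qed.

Lemma message_homo : {homo message : x y / x <= y}.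
Proof.
move=> x y xy; have a1 := A_gt1.
have ex := expR_gt0 x; have ey := expR_gt0 y.
have exy : expR x <= expR y by rewrite ler_expR.
set a := expR x in ex exy; set b := expR y in ey exy.
have px : 0 < A * a + 1 by nra.
have py : 0 < A * b + 1 by nra.
have qx : 0 < a + A by lra.
have qy : 0 < b + A by lra.
rewrite /message -/a -/b -!ln_div ?posrE// ler_ln ?posrE ?divr_gt0//.
rewrite ler_pdivrMr// mulrAC ler_pdivlMr// -subr_ge0.
have -> : (A * b + 1) * (a + A) - (A * a + 1) * (b + A) =
  (A ^+ 2 - 1) * (b - a) by ring.
by apply: mulr_ge0; nra.
Qed.

Lemma message_ge0 (x : R) : 0 <= x -> 0 <= message x.
Proof. by rewrite -{2}message0; exact: message_homo. Qed.

Lemma message_gt0 (x : R) : 0 < x -> 0 < message x.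
Proof.
move=> x0; have a1 := A_gt1; have e1 : 1 < expR x by rewrite expR_gt1.
set e := expR x in e1.
rewrite /message -/e subr_gt0 ltr_ln ?posrE; nra.
Qed.

Lemma message_le_ln (x : R) : message x <= ln A.
Proof.
have a1 := A_gt1; have e0 := expR_gt0 x.
set e := expR x in e0.
have px : 0 < A * e + 1 by nra.
have qx : 0 < e + A by lra.
have p : 0 < A by lra.
rewrite /message -/e -ln_div ?posrE// ler_ln ?posrE ?divr_gt0//.
by rewrite ler_pdivrMr//; nra.
Qed.

Lemma expR_message (x : R) : expR (message x) = (A * expR x + 1) / (expR x + A).
Proof.
have a1 := A_gt1; have e0 := expR_gt0 x.
have px : 0 < A * expR x + 1 by nra.
have qx : 0 < expR x + A by lra.
by rewrite /message -ln_div ?posrE// lnK// posrE divr_gt0.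
Qed.

Lemma continuous_message : continuous message.
Proof.
move=> x; apply/differentiable_continuous/derivable1_diffP.
by have [] := is_derive_message x.
Qed.

Let saturate (k x : R) : R := theta * (x / Num.sqrt (1 + k * x ^+ 2)).

(** The derivative is [theta] over the power 3/2 of [1 + k x^2], so comparing [saturate k] with
    [message] amounts to comparing that power with [1 + c * excess x]. *)
Let is_derive_saturate (k x : R) : 0 < k ->
  is_derive x 1 (saturate k)
    (theta / (Num.sqrt (1 + k * x ^+ 2) * (1 + k * x ^+ 2))).
Proof.
move=> k0; set s := 1 + k * x ^+ 2.
have s0 : 0 < s by rewrite /s; nra.
have d1 : is_derive x 1 (fun u : R => 1 + k * u ^+ 2) (2 * k * x).
  apply: is_derive_eq.
  by rewrite /GRing.scale /=; ring.
have d2 := @is_derive1_comp R Num.sqrt (fun u : R => 1 + k * u ^+ 2) x _ _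
  (is_derive1_sqrt s0) d1.
have sq0 : 0 < Num.sqrt s by rewrite sqrtr_gt0.
have d3 := @is_deriveV R (Num.sqrt \o (fun u : R => 1 + k * u ^+ 2)) x _ 1
  (lt0r_neq0 sq0) d2.
apply: is_derive_eq; rewrite /= -/s /GRing.scale /=.
have e : s = Num.sqrt s ^+ 2 by rewrite sqr_sqrtr// ltW.
have e' : k * x ^+ 2 = Num.sqrt s ^+ 2 - 1 by rewrite -e /s; ring.
set q := Num.sqrt s in sq0 e e' *; rewrite [in RHS]e.
rewrite ?mulr1.
transitivity (theta * (q ^-1 - (k * x ^+ 2) / q ^+ 3)).
  by field; rewrite gt_eqF.
by rewrite e'; field; rewrite gt_eqF.
Qed.

Lemma message_upper : exists2 k : R, 0 < k &
  forall x, 0 <= x -> message x ^+ 2 * (1 + k * x ^+ 2) <= theta ^+ 2 * x ^+ 2.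
Proof.
have c0 := c_gt0; have c1 := c_le1; have t0 := theta_gt0.
(* As [1 + k u^2 >= 1], its power 3/2 is at most its square, which is [1 + c u^2 / 2 + c^2 u^4 / 16]
   for this [k]; by [excess_ge] and [c <= 1] that is at most [1 + c * excess u]. *)
exists (c / 4); first lra.
set k := c / 4 => x x0; have k0 : 0 < k by rewrite /k; lra.
have s0 u : 0 < 1 + k * u ^+ 2 by nra.
have q0 u : 0 < Num.sqrt (1 + k * u ^+ 2) by rewrite sqrtr_gt0.
suff le_fs : message x <= saturate k x.
  rewrite -[X in _ * X]sqr_sqrtr ?(ltW (s0 _))// -!exprMn.
  rewrite ler_sqr ?nnegrE ?(mulr_ge0 (message_ge0 _)) ?(mulr_ge0 (ltW t0))
    ?message_ge0 ?(ltW (q0 _))//.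
  by rewrite -ler_pdivlMr// -mulrA.
have ds (u : R) := is_derive_saturate u k0.
apply: (le_of_derive is_derive_message ds) => //.
  by rewrite message0 /saturate mul0r mulr0.
move=> u /andP[u0 _].
rewrite ler_pM2l// lef_pV2 ?posrE ?mulr_gt0//; last first.
  by have := excess_ge0 u; nra.
have sqrt_le : Num.sqrt (1 + k * u ^+ 2) <= 1 + k * u ^+ 2.
  rewrite -[leRHS]ger0_norm ?(ltW (s0 _))// -sqrtr_sqr ler_wsqrtr//.
  nra.
apply: (@le_trans _ _ ((1 + k * u ^+ 2) ^+ 2)).
  by rewrite expr2 ler_pM2r ?s0.
have := @excess_ge u (ltW u0); rewrite /k.
have -> : u ^+ 4 = (u ^+ 2) ^+ 2 by rewrite -exprM.
set w := u ^+ 2; have w0 : 0 <= w by exact: sqr_ge0.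
move=> h; have := ler_wpM2l (ltW c0) h.
have : 0 <= w ^+ 2 by exact: sqr_ge0.
set w2 := w ^+ 2 => w20.
rewrite sqrrD expr1n mul1r exprMn -/w2.
have : c ^+ 2 * w2 <= c * w2 by rewrite ler_wpM2r// expr2; nra.
have cw : 0 <= c * w by rewrite mulr_ge0 ?(ltW c0).
by move=> h1 h2; set e := excess u in h2 *; lra.
Qed.

(** The ratio [theta / Num.sqrt k] is the supremum of the minorant. Its bound by [ln A] serves the
    vertices on the boundary of the volume, whose message is exactly [ln A]. *)
Lemma message_lower : exists2 k : R, 0 < k &
  theta / Num.sqrt k <= ln A /\
  forall x, 0 <= x -> theta * (x / Num.sqrt (1 + k * x ^+ 2)) <= message x.
Proof.
have c0 := c_gt0; have c1 := c_le1; have t0 := theta_gt0.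
have f1 : 0 < message 1 by apply: message_gt0.
(* The first summand handles [x <= 1] by comparing derivatives; the second one
   makes the left-hand side at most [message 1], which settles [x > 1]. *)
pose k := c * expR 1 + (theta / message 1) ^+ 2.
have e1 := expR_gt0 (1 : R).
have kc : 0 < c * expR 1 by rewrite mulr_gt0.
have kt : 0 < (theta / message 1) ^+ 2 by rewrite exprn_gt0// divr_gt0.
have k0 : 0 < k by rewrite addr_gt0.
have sk : theta / message 1 <= Num.sqrt k.
  have f0 : 0 <= theta / message 1 by rewrite divr_ge0// ltW.
  rewrite -[leLHS]ger0_norm// -sqrtr_sqr ler_wsqrtr// /k; lra.
have sk0 : 0 < Num.sqrt k by rewrite sqrtr_gt0.
have tk : theta / Num.sqrt k <= message 1.
  by rewrite ler_pdivrMr// mulrC -ler_pdivrMr.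
exists k => //; split; first exact: le_trans tk (message_le_ln _).
have s0 u : 0 < 1 + k * u ^+ 2 by nra.
have q0 u : 0 < Num.sqrt (1 + k * u ^+ 2) by rewrite sqrtr_gt0.
move=> x x0; have [x1|x1] := leP x 1; last first.
  apply: le_trans (message_homo (ltW x1)); apply: le_trans tk.
  rewrite ler_pM2l// ler_pdivrMr// mulrC ler_pdivlMr//.
  rewrite -[leLHS]ger0_norm; last by rewrite mulr_ge0// ltW.
  rewrite -sqrtr_sqr ler_wsqrtr// exprMn sqr_sqrtr ?(ltW k0)//; nra.
have ds (u : R) := is_derive_saturate u k0.
apply: (le_of_derive ds is_derive_message) => //.
  by rewrite message0 /saturate mul0r mulr0.
move=> u /andP[u0 ux].
have s1 : 1 + c * excess u <= 1 + k * u ^+ 2.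
  have := @excess_le u; rewrite (ltW u0) (le_trans (ltW ux) x1) => /(_ isT) h.
  have := ler_wpM2l (ltW c0) h; rewrite /k; nra.
rewrite ler_pM2l// lef_pV2 ?posrE ?mulr_gt0//; last first.
  by have := excess_ge0 u; nra.
apply: le_trans s1 _; rewrite ler_peMl ?(ltW (s0 _))//.
by rewrite -[leLHS]sqrtr1 ler_wsqrtr// lerDl mulr_ge0 ?(ltW k0) ?sqr_ge0.
Qed.

End Message.

(** * Rooted trees *)

Section TreeTheory.
Context (V : choiceType) (T : tree V) (o : V).

Local Notation depth := (dist T o).

Lemma dist_le (x y : V) (p : seq V) :
  path (adj T) x p -> last x p = y -> (dist T x y <= size p)%N.
Proof.
move=> xp py; rewrite /dist; case: ex_minnP => n _; apply.
by apply/asboolP; exists p.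
Qed.

Lemma geodesic_exists (x y : V) : exists p : seq V,
  [/\ path (adj T) x p, last x p = y, size p = dist T x y & uniq (x :: p)].
Proof.
have [p [xp py sp]] : exists p : seq V,
    [/\ path (adj T) x p, last x p = y & size p = dist T x y].
  by rewrite /dist; case: ex_minnP => n /asboolP.
case: (shortenP xp) py => p' xp' up' sub p'y.
exists p'; split=> //; apply/eqP; rewrite eqn_leq dist_le// andbT -sp.
by have /uniq_leq_size := sub; apply; case/andP: up'.
Qed.

Lemma distxx (x : V) : dist T x x = 0%N.
Proof. by apply/eqP; rewrite -leqn0 (@dist_le x x [::]). Qed.

Lemma dist_eq0 (v : V) : (depth v == 0%N) = (v == o).
Proof.
apply/idP/eqP => [/eqP v0|->]; last by rewrite distxx.
have [p [_ pv sp _]] := geodesic_exists o v.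
by move: sp pv; rewrite v0 => /size0nil ->.
Qed.

Lemma simple_path_uniq (x y : V) (p q : seq V) :
  path (adj T) x p -> last x p = y -> uniq (x :: p) ->
  path (adj T) x q -> last x q = y -> uniq (x :: q) -> p = q.
Proof.
move=> xp py up xq qy uq; have [r [_ ru]] := adj_path T x y.
by rewrite -(ru p) ?(ru q).
Qed.

(** If [w] were on the geodesic [p], the part of [p] up to [w] would already have length at least
    [depth u], forcing [w = u]. Hence [rcons p w] is simple, and simple paths are unique. *)
Lemma geodesic_rcons (u w : V) (p q : seq V) :
  adj T u w -> (depth u <= depth w)%N ->
  path (adj T) o p -> last o p = u -> size p = depth u -> uniq (o :: p) ->
  path (adj T) o q -> last o q = w -> uniq (o :: q) -> q = rcons p w.
Proof.
move=> uw le_uw op pu sp up oq qw uq.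
apply: (simple_path_uniq oq qw uq); rewrite ?last_rcons ?rcons_path ?op ?pu//.
rewrite -rcons_cons rcons_uniq up andbT; apply/negP => wp.
case/splitPl defp: p / wp up pu op sp => [p1 p2 p1w] _.
rewrite last_cat p1w cat_path => p2u /andP[op1 _] sp.
have := dist_le op1 p1w => le_w1.
have p20 : size p2 = 0%N.
  apply/eqP; rewrite -leqn0 -(leq_add2l (size p1)) addn0 -size_cat sp.
  exact: leq_trans le_uw _.
by move: uw; rewrite -p2u (size0nil p20)/= adj_irr.
Qed.

Lemma adj_dist (u w : V) :
  adj T u w -> (depth u <= depth w)%N -> depth w = (depth u).+1.
Proof.
move=> uw le_uw; have [p [op pu sp up]] := geodesic_exists o u.
have [q [oq qw <- uq]] := geodesic_exists o w.
by rewrite (geodesic_rcons uw le_uw op pu sp up oq qw uq) size_rcons sp.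
Qed.

Lemma dist_parent (v w : V) : parent T o v w -> depth w = (depth v).+1.
Proof. by move=> /andP[vw lt_vw]; apply: adj_dist vw (ltnW lt_vw). Qed.

Lemma adj_parent (u w : V) : adj T u w -> parent T o u w \/ parent T o w u.
Proof.
move=> uw; case: (leqP (depth u) (depth w)) => [le_uw|lt_wu].
  by left; rewrite /parent uw (adj_dist uw le_uw)/=.
by right; rewrite /parent (adj_sym T) uw.
Qed.

Lemma parent_uniq (u v w : V) : parent T o u w -> parent T o v w -> u = v.
Proof.
move=> /andP[uw lt_uw] /andP[vw lt_vw].
have [p [op pu sp up]] := geodesic_exists o u.
have [p' [op' pv sp' up']] := geodesic_exists o v.
have [q [oq qw _ uq]] := geodesic_exists o w.
have := geodesic_rcons uw (ltnW lt_uw) op pu sp up oq qw uq.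
rewrite (geodesic_rcons vw (ltnW lt_vw) op' pv sp' up' oq qw uq).
by move=> /rcons_inj[pp']; rewrite -pu -pv pp'.
Qed.

Lemma parent_exists (w : V) : w != o -> exists v, parent T o v w.
Proof.
move=> wo; have [p [op pw sp up]] := geodesic_exists o w.
move: op pw sp {up}; case/lastP: p => [_ ow|p x]; first by rewrite -ow eqxx in wo.
rewrite rcons_path last_rcons size_rcons => /andP[op px] xw sp.
by exists (last o p); rewrite /parent -sp ltnS dist_le// andbT -xw.
Qed.

(* Junk value: [up o = o]. *)
Definition up (w : V) : V := xget o [set v | parent T o v w].

Lemma parentP (v w : V) : reflect (w != o /\ up w = v) (parent T o v w).
Proof.
apply: (iffP idP) => [vw|[wo <-]]; last first.
  apply: (@xgetPex _ o [set v | parent T o v w]); exact: parent_exists.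
split; first by rewrite -dist_eq0 (dist_parent vw).
apply: (parent_uniq _ vw); apply: (@xgetPex _ o [set v | parent T o v w]).
by exists v.
Qed.

Lemma parent_up (w : V) : w != o -> parent T o (up w) w.
Proof. by move=> wo; apply/parentP. Qed.

Lemma dist_up (w : V) : w != o -> depth w = (depth (up w)).+1.
Proof. by move=> /parent_up/dist_parent. Qed.

Lemma parent_neq (v w : V) : parent T o v w -> w != o.
Proof. by case/parentP. Qed.

Lemma up_parent (v w : V) : parent T o v w -> up w = v.
Proof. by case/parentP. Qed.

Hypothesis T_lf : locally_finite T.

Lemma finite_children (v : V) : finite_set (children T o v).
Proof. by apply: sub_finite_set (T_lf v) => w /andP[]. Qed.

Definition kids (v : V) : {fset V} := fset_set (children T o v).

Lemma in_kids (v w : V) : (w \in kids v) = parent T o v w.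
Proof.
rewrite in_fset_set; last exact: finite_children.
by apply/idP/idP; rewrite inE.
Qed.

Lemma sum_children (R : realType) (v : V) (F : V -> R) :
  \sum_(y \in children T o v) F y = \sum_(y <- kids v) F y.
Proof. by rewrite fsbig_finite//; exact: finite_children. Qed.

Lemma finite_level (n : nat) : finite_set (level T o n).
Proof.
elim: n => [|n IHn].
  apply: (@sub_finite_set _ _ [set o]) => // v /= /eqP.
  by rewrite dist_eq0 => /eqP.
apply: (@sub_finite_set _ _ (\bigcup_(v in level T o n) children T o v)).
  move=> w /= wn; have wo : w != o by rewrite -dist_eq0 wn.
  exists (up w); last exact: parent_up.
  by move: wn; rewrite /level/= (dist_up wo) => -[].
apply: bigcup_finite => // v _; exact: finite_children.
Qed.

Lemma finite_ball (n : nat) : finite_set [set v | (depth v <= n)%N].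
Proof.
apply: (@sub_finite_set _ _ (\bigcup_(k in `I_n.+1) level T o k)).
  by move=> v /= vn; exists (depth v).
by apply: bigcup_finite => // k _; exact: finite_level.
Qed.

Lemma in_ball (n : nat) (v : V) : (v \in Defs.ball T o n) = (depth v <= n)%N.
Proof.
by rewrite in_fset_set; [apply/idP/idP; rewrite inE|exact: finite_ball].
Qed.

Lemma in_level (n : nat) (v : V) : (v \in fset_set (level T o n)) = (depth v == n).
Proof.
rewrite in_fset_set; last exact: finite_level.
by apply/idP/eqP; rewrite inE.
Qed.

Hypothesis T_inf : infinite_set [set: V].
Hypothesis T_nl : forall v : V, v != o -> ~ leaf T v.

(** A vertex other than [o] without children has its parent as only neighbor, so it is a leaf. If
    [o] had no children, no path would leave [o] and the tree would be finite. *)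
Lemma kid_exists (v : V) : exists w, parent T o v w.
Proof.
have [->|vo] := eqVneq v o; last first.
  apply: contrapT => nch; apply: (T_nl vo); exists (up v).
  apply/seteqP; split => [w /= vw|w /= ->]; last first.
    by have /andP[+ _] := parent_up vo; rewrite (adj_sym T).
  have [vw'|/up_parent ->//] := adj_parent vw.
  by case: nch; exists w.
apply: contrapT => nch; apply: T_inf.
apply: (@sub_finite_set _ _ [set o]) => // w _ /=.
apply/eqP; apply: contrapT => /negP vo.
have [p [+ pv sp up]] := geodesic_exists o w.
case: p pv sp up => [ov|u p _ _ _ /= /andP[ow _]]; first by rewrite -ov eqxx in vo.
have [ow'|] := adj_parent ow; first by apply: nch; exists u.
by rewrite /parent distxx ltn0 andbF.
Qed.

Definition down (v : V) : V := xget o [set w | parent T o v w].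

Lemma parent_down (v : V) : parent T o v (down v).
Proof.
by apply: (@xgetPex _ o [set w | parent T o v w]); exact: kid_exists.
Qed.

Lemma dist_iter_up (v : V) (k : nat) :
  (k <= depth v)%N -> depth (iter k up v) = (depth v - k)%N.
Proof.
elim: k => [|k IHk] kv; first by rewrite subn0.
have ik := IHk (ltnW kv).
have ko : iter k up v != o by rewrite -dist_eq0 ik subn_eq0 -ltnNge.
by move: (dist_up ko); rewrite ik -iterS subnS => ->.
Qed.

(** The path follows the ancestors of [v] and then descends forever through chosen children. This
    lets a supremum over infinite paths be tested at vertices. *)
Lemma boundary_through (v : V) : exists2 y : nat -> V, boundary T o y &
  forall i, (i <= depth v)%N -> y (depth v - i)%N = iter i up v.
Proof.
pose y k := if (k <= depth v)%N then iter (depth v - k)%N up v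
            else iter (k - depth v)%N down v.
exists y; last first.
  by move=> i iv; rewrite /y leq_subr subKn.
split.
  rewrite /y leq0n subn0; apply/eqP; rewrite -dist_eq0.
  by rewrite dist_iter_up// subnn.
move=> k; rewrite /y; case: (ltngtP k (depth v)) => [kv|vk|kv].
- have e : (depth v - k)%N = (depth v - k.+1).+1 by rewrite subnSK.
  rewrite e iterS; apply: parent_up.
  by rewrite -dist_eq0 dist_iter_up ?leq_subr// subKn.
- by rewrite subSn ?(ltnW vk)// iterS; exact: parent_down.
- by rewrite kv subnn subSnn; exact: parent_down.
Qed.

End TreeTheory.

(** * The Gibbs measure on a finite rooted tree *)

Section SumOut.
Context (R : realType) (B : finType).
Implicit Types (eta : {ffun B -> bool}).

Definition flip (x : B) eta : {ffun B -> bool} :=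
  [ffun v => if v == x then ~~ eta v else eta v].

Lemma flipK (x : B) : involutive (flip x).
Proof.
move=> eta; apply/ffunP => v; rewrite !ffunE.
by case: eqP => // _; rewrite negbK.
Qed.

Lemma flip_same (x : B) eta : flip x eta x = ~~ eta x.
Proof. by rewrite ffunE eqxx. Qed.

Lemma flip_other (x v : B) eta : v != x -> flip x eta v = eta v.
Proof. by rewrite ffunE => /negbTE ->. Qed.

(* Averaging over the involutions [flip x] for [x] in [s] replaces the spin at
   [x] by its mean over both values, so no sum over smaller configuration spaces
   is ever needed. *)
Lemma sum_out (s : seq B) (F : {ffun B -> bool} -> R)
    (psi : B -> bool -> {ffun B -> bool} -> R) : uniq s ->
  (forall x eta, x \in s -> F (flip x eta) = F eta) ->
  (forall x v c eta, x \in s -> v \in s ->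
    psi v c (flip x eta) = psi v c eta) ->
  \sum_eta F eta * \prod_(v <- s) psi v (eta v) eta =
  \sum_eta F eta * \prod_(v <- s) ((psi v true eta + psi v false eta) / 2).
Proof.
elim: s F => [|x s IHs] F /=.
  by move=> _ _ _; apply: eq_bigr => eta _; rewrite !big_nil.
move=> /andP[xs us] F_flip psi_flip.
pose G eta := F eta * \prod_(v <- s) psi v (eta v) eta.
have G_flip eta : G (flip x eta) = G eta.
  rewrite /G F_flip ?mem_head//; congr (_ * _).
  rewrite !(big_seq_cond predT); apply: eq_bigr => v /andP[vs _].
  rewrite psi_flip ?mem_head ?in_cons ?vs ?orbT// flip_other//.
  by apply: contraNneq xs => <-.
pose Q eta := (psi x true eta + psi x false eta) / 2.
transitivity (\sum_eta G eta * psi x (eta x) eta).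
  by apply: eq_bigr => eta _; rewrite big_cons /G; ring.
have half (a : R) : a = (a + a) / 2 by field.
(* [G] is invariant under [flip x], so pairing each configuration with its flip averages the factor
   at [x] alone. *)
rewrite [LHS]half {2}(reindex_inj (can_inj (flipK x))) -big_split/= mulr_suml.
transitivity (\sum_eta (F eta * Q eta) * \prod_(v <- s) psi v (eta v) eta).
  apply: eq_bigr => eta _; rewrite G_flip psi_flip ?mem_head// flip_same /G /Q.
  by case: (eta x) => /=; field.
rewrite IHs//.
- by apply: eq_bigr => eta _; rewrite big_cons /Q; ring.
- move=> y eta ys; rewrite F_flip ?in_cons ?ys ?orbT//; congr (_ * _).
  by rewrite /Q !psi_flip ?in_cons ?ys ?eqxx ?orbT.
- by move=> y v c eta ys vs; rewrite psi_flip// in_cons ?ys ?vs orbT.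
Qed.

Context (up : B -> B) (d : B -> nat) (r : B).
Hypothesis d_r : forall v, (d v == 0%N) = (v == r).
Hypothesis d_up : forall v, v != r -> d v = (d (up v)).+1.

Context (E : bool -> bool -> R) (phi h : B -> bool -> R).
Hypothesis hE : forall v b, h v b = phi v b *
  \prod_(u | (u != r) && (up u == v))
    ((E b true * h u true + E b false * h u false) / 2).


Let d_up_level (v : B) (k : nat) : d v = k.+1 -> d (up v) = k.
Proof. by move=> dv; apply/succn_inj; rewrite -dv [RHS]d_up// -d_r dv. Qed.

(* The restricted partition function after the vertices deeper than [k] have
   been summed out. *)
Let Z (b : bool) (k : nat) : R :=
  \sum_(eta : {ffun B -> bool}) (eta r == b)%:R *
    (\prod_(v | (v != r) && (d v <= k)%N) E (eta (up v)) (eta v)) *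
    (\prod_(v | (d v < k)%N) phi v (eta v)) * (\prod_(v | d v == k) h v (eta v)).

Let Z_step (b : bool) (k : nat) : Z b k.+1 = Z b k.
Proof.
(* Given the spins at depth at most [k], the factors of the vertices of [s] decouple: [F] involves
   no spin of [s], and [psi v c] depends only on the spin of the parent of [v]. *)
pose s := [seq v <- index_enum B | d v == k.+1].
have us : uniq s by rewrite filter_uniq// index_enum_uniq.
have sP v : (v \in s) = (d v == k.+1) by rewrite mem_filter mem_index_enum andbT.
pose F eta := (eta r == b)%:R *
  (\prod_(v | (v != r) && (d v <= k)%N) E (eta (up v)) (eta v)) *
  (\prod_(v | (d v < k.+1)%N) phi v (eta v)).
pose psi v c (eta : {ffun B -> bool}) := E (eta (up v)) c * h v c.
have s_neq x v : x \in s -> (d v <= k)%N -> v != x.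
  rewrite sP => /eqP dx dv; apply: contraTneq dv => ->.
  by rewrite dx -ltnNge.
have r_neq x : x \in s -> r != x.
  by move=> xs; apply: s_neq xs _; move: (d_r r); rewrite eqxx => /eqP ->.
transitivity (\sum_eta F eta * \prod_(v <- s) psi v (eta v) eta).
  apply: eq_bigr => eta _; rewrite /F -!mulrA; congr (_ * _).
  rewrite big_filter/= (bigID (fun v => d v == k.+1))/=.
  rewrite [X in X * _ * _](_ : _ =
    \prod_(v | d v == k.+1) E (eta (up v)) (eta v)).
    rewrite big_split/= [X in _ * X * _](_ : _ =
      \prod_(v | (v != r) && (d v <= k)%N) E (eta (up v)) (eta v)); first ring.
    apply: eq_bigl => v.
    by rewrite -andbA -(ltnS (d v) k) ltn_neqAle (andbC (_ != k.+1)).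
  apply: eq_bigl => v; rewrite -d_r; case: (ltngtP (d v) k.+1); rewrite ?andbF//.
  by move=> ->.
rewrite sum_out//; first last.
- move=> x v c eta xs; rewrite sP => /eqP dv; rewrite /psi flip_other//.
  by rewrite s_neq// (d_up_level dv).
- move=> x eta xs; rewrite /F flip_other ?r_neq//; congr (_ * _ * _).
    apply: eq_bigr => v /andP[vr vk]; rewrite !flip_other ?s_neq//.
    by rewrite (leq_trans _ vk)// [leqRHS]d_up.
  by apply: eq_bigr => v vk; rewrite flip_other ?s_neq.
apply: eq_bigr => eta _; rewrite /F -!mulrA; congr (_ * (_ * _)).
rewrite (bigID (fun v => d v == k))/= mulrAC mulrC; congr (_ * _).
  by apply: eq_bigl => v; rewrite ltnS leq_eqVlt; case: ltngtP.
(* Grouping the averaged factors by parent reproduces the right-hand side of [hE] at depth [k]. *)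
rewrite big_filter/= [X in _ * X](partition_big up (fun v => d v == k))/=;
  last by move=> v /eqP/d_up_level ->.
rewrite [X in X * _](eq_bigl (fun v => d v == k)); last first.
  by move=> v; rewrite ltnS leq_eqVlt; case: ltngtP.
rewrite -big_split/=; apply: eq_bigr => v /eqP dv; rewrite [RHS]hE.
congr (_ * _); rewrite [RHS](eq_bigl (fun u => (d u == k.+1) && (up u == v))).
  by apply: eq_bigr => u /andP[_ /eqP <-].
move=> u; case: eqVneq => [->|ur]/=.
  by move: (d_r r); rewrite eqxx => /eqP ->.
by rewrite (d_up ur) eqSS; case: eqP => [->|]; rewrite ?dv ?eqxx ?andbF.
Qed.

(** The root marginal is proportional to [h r]. Spins are averaged rather than removed, so [K]
    counts the configurations with a prescribed root spin; flipping the root shows that it does not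
    depend on [b]. *)
Lemma tree_partition_function : exists2 K : R, 0 < K & forall b,
  \sum_(eta : {ffun B -> bool}) (eta r == b)%:R *
    (\prod_(v | v != r) E (eta (up v)) (eta v)) * (\prod_v phi v (eta v)) =
  K * h r b.
Proof.
pose count (b : bool) : R := \sum_(eta : {ffun B -> bool}) (eta r == b)%:R.
exists (count true).
  rewrite /count (bigD1 [ffun=> true])//= ffunE eqxx ltr_pwDl// sumr_ge0//.
(* Beyond the maximal depth no vertex carries [h], and [Z] is the full sum; at depth [0] only the
   factor [h r] is left. *)
move=> b; transitivity (Z b (\max_v d v).+1).
  apply: eq_bigr => eta _.
  have dmax v : (d v < (\max_v d v).+1)%N by rewrite ltnS leq_bigmax.
  rewrite [X in _ = _ * X]big_pred0 ?mulr1; last first.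
    by move=> v; rewrite ltn_eqF.
  congr (_ * _ * _); apply: eq_bigl => v; first by rewrite (ltnW (dmax v)) andbT.
  by rewrite dmax.
have -> : Z b (\max_v d v).+1 = Z b 0 by elim: (_.+1) => // k <-; rewrite Z_step.
transitivity (count b * h r b).
  rewrite /count mulr_suml; apply: eq_bigr => eta _.
  rewrite big_pred0; last by move=> v; rewrite leqn0 d_r; case: eqP.
  rewrite big_pred0// (big_pred1 r)//.
  by rewrite !mulr1; case: eqP => [->//|]; rewrite !mul0r.
congr (_ * _); case: b => //; rewrite /count (reindex_inj (can_inj (flipK r)))/=.
by apply: eq_bigr => eta _; rewrite flip_same; case: (eta r).
Qed.

End SumOut.

(** * The recursion for log-likelihood ratios in a finite volume *)

Section IsingRecursion.
Context (R : realType) (V : choiceType) (T : tree V) (o : V) (J beta : R).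
Hypothesis T_lf : locally_finite T.
Hypothesis bJ_gt0 : 0 < beta * J.

Local Notation depth := (dist T o).
Local Notation kids := (kids T o).

Let E (b c : bool) : R := expR (beta * J * spin R b * spin R c).

Let A : R := expR (2 * (beta * J)).

Let A_gt1 : 1 < A.
Proof. by rewrite expR_gt1 mulr_gt0. Qed.

(* The message sent to its parent by a vertex [w] whose subtree is cut off, with
   plus boundary conditions, [n] levels below [w]. *)
Fixpoint log_ratio (n : nat) (w : V) : R :=
  if n is n'.+1 then message A (\sum_(y <- kids w) log_ratio n' y)
  else 2 * (beta * J).

(* [H n v b]: normalized partition function of the first [n] levels below [v],
   with plus boundary conditions and spin [b] at [v]. *)
Let H := fix H (n : nat) (v : V) (b : bool) : R :=
  if n is n'.+1 then
    \prod_(u <- kids v)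
      ((E b true * H n' u true + E b false * H n' u false) / 2)
  else b%:R.

(** Ratios are taken for [M] rather than [H]: on the boundary [H 0 u false = 0], while [M 0 u]
    already has the finite log-ratio [2 * (beta * J)]. *)
Let M n u b : R := (E b true * H n u true + E b false * H n u false) / 2.

Let H_ratio (n : nat) (v : V) :
  (forall u, 0 < M n u false /\ M n u true = expR (log_ratio n u) * M n u false) ->
  0 < H n.+1 v false /\
  H n.+1 v true = expR (\sum_(y <- kids v) log_ratio n y) * H n.+1 v false.
Proof.
move=> M_ratio; split.
  rewrite /= big_seq; elim/big_rec: _ => // y x _ x0.
  by rewrite mulr_gt0//; case: (M_ratio y).
rewrite /= expR_sum -big_split/=; apply: eq_bigr => y _.
by case: (M_ratio y).
Qed.

Let M_ratio (n : nat) (u : V) :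
  0 < M n u false /\ M n u true = expR (log_ratio n u) * M n u false.
Proof.
have Et b c : E b c = expR (if b == c then beta * J else - (beta * J)).
  by rewrite /E; case: b; case: c; rewrite /spin/= ?mulr1 ?mulrN1 ?opprK.
elim: n u => [|n IHn] u.
  rewrite /M /= !mulr1 !mulr0 !addr0 !Et /= divr_gt0 ?expR_gt0//; split=> //.
  by rewrite mulrA -expRD; congr (expR _ / 2); ring.
have [h0 h1] := H_ratio u IHn.
rewrite {1 2 3}/M h1 !Et /=; set x := \sum_(y <- _) _; set h := H _ _ _ in h0 *.
have ex := expR_gt0 x; have eb := expR_gt0 (beta * J).
have eb' := expR_gt0 (- (beta * J)).
split; first by rewrite divr_gt0// addr_gt0// !mulr_gt0.
rewrite (expR_message A_gt1) -/x.
have -> : A = expR (beta * J) ^+ 2 by rewrite -expRM_natl.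
rewrite expRN; set e := expR (beta * J) in eb *; set z := expR x in ex *.
by field; rewrite !gt_eqF ?addr_gt0 ?exprn_gt0.
Qed.

Section Volume.
Context (N : nat).
Let B : finType := Defs.ball T o N.

Let oB_subproof : o \in Defs.ball T o N.
Proof. by rewrite in_ball// distxx. Qed.

Let oB : B := [` oB_subproof]%fset.

Let upB (v : B) : B := insubd v (up T o (val v)).

Let val_upB (v : B) : v != oB -> val (upB v) = up T o (val v).
Proof.
move=> vo; rewrite val_insubd; case: ifP => // /negP[].
have vo' : val v != o by apply: contraNneq vo => vo; apply/eqP/val_inj.
have := fsvalP v; rewrite !in_ball// => vN.
by rewrite (leq_trans _ vN)// (dist_up T vo').
Qed.

Let neq_oB (v : B) : (v != oB) = (val v != o).
Proof. by rewrite -(inj_eq val_inj). Qed.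

Let parentB (v w : B) : parent T o (val v) (val w) = (w != oB) && (upB w == v).
Proof.
apply/parentP/andP => [[wo wv]|[wo /eqP <-]].
  by rewrite neq_oB wo -(inj_eq val_inj) val_upB ?neq_oB// wv.
by rewrite -neq_oB wo val_upB.
Qed.

(** The plus boundary condition as a vertex weight, so that sums over [plus_configs] become sums
    over all configurations. *)
Let phi (v : B) (b : bool) : R := if depth (val v) == N then b%:R else 1.

Let hB (v : B) (b : bool) : R := H (N - depth (val v)) (val v) b.

Let weightE (eta : config T o N) :
  weight J beta eta = \prod_(v : B | v != oB) E (eta (upB v)) (eta v).
Proof.
rewrite /weight -(pair_big_dep predT (fun v w : B => parent T o (val v) (val w))
  (fun v w => E (eta v) (eta w)))/=.
rewrite (exchange_big_dep (fun w => w != oB))/=; last first.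
  by move=> v w _; rewrite parentB => /andP[].
apply: eq_bigr => w wo; rewrite (big_pred1 (upB w))// => v.
by rewrite parentB wo eq_sym.
Qed.

Let phiE (eta : config T o N) :
  \prod_(v : B) phi v (eta v) = (eta \in plus_configs T o N)%:R.
Proof.
rewrite finset.inE.
case: (boolP [forall v : B, (depth (val v) == N) ==> eta v]).
  move=> /forallP all_plus.
  rewrite big1// => v _; rewrite /phi; case: ifP => // vN.
  by move: (all_plus v); rewrite vN /= => ->.
rewrite negb_forall => /existsP[v]; rewrite negb_imply => /andP[vN etav].
by rewrite (bigD1 v)//= /phi vN (negbTE etav) mul0r.
Qed.

Let hBE (v : B) (b : bool) : hB v b = phi v b *
  \prod_(u | (u != oB) && (upB u == v))
    ((E b true * hB u true + E b false * hB u false) / 2).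
Proof.
rewrite /hB /phi; have := fsvalP v; rewrite in_ball// leq_eqVlt.
case: eqP => [vN _|_ /= vN].
  rewrite vN subnn /= big_pred0 ?mulr1// => u; rewrite -parentB.
  apply/negP => /dist_parent; have := fsvalP u; rewrite in_ball// vN => uN uN1.
  by rewrite uN1 ltnn in uN.
rewrite mul1r -[(N - _)%N]subnSK//=.
transitivity (\prod_(u : B | parent T o (val v) (val u))
  M (N - (depth (val v)).+1) (val u) b).
  rewrite -(big_seq_fsetE _ (Defs.ball T o N) (parent T o (val v))
    (fun u => M _ u b))/=.
  rewrite -[RHS]big_filter; apply: perm_big; apply: uniq_perm.
  - exact: fset_uniq.
  - by rewrite filter_uniq// fset_uniq.
  move=> u; rewrite mem_filter in_kids// in_ball//.
  by case: (boolP (parent _ _ _ _)) => //= /dist_parent ->.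
apply: eq_big => [u|u vu]; first by rewrite parentB.
by rewrite /M (dist_parent vu).
Qed.

(** The likelihood ratio at the root is [e^X], with [X] the sum of the messages of its children,
    which lie [N - 1] levels above the boundary. For [N = 0] the root itself is on the boundary and
    this ratio is infinite. *)
Lemma root_plusE : (0 < N)%N -> plus_measure J beta (root_plus T o N) =
  1 - (1 + expR (\sum_(y <- kids o) log_ratio N.-1 y))^-1.
Proof.
have d_r (v : B) : (depth (val v) == 0%N) = (v == oB).
  by rewrite dist_eq0 -(inj_eq val_inj).
have d_up (v : B) : v != oB -> depth (val v) = (depth (val (upB v))).+1.
  by move=> vo; rewrite val_upB//; apply: dist_up; rewrite -neq_oB.
have [K K0 KE] := tree_partition_function d_r d_up hBE.
move=> N0; rewrite /plus_measure.
have rootE eta : (eta \in root_plus T o N) = eta oB.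
  rewrite inE; apply/existsP/idP => [[v /andP[/eqP vo]]|etao].
    by rewrite (_ : v = oB)//; exact: val_inj.
  by exists oB; rewrite eqxx.
have -> : \sum_(eta in plus_configs T o N) weight J beta eta =
    K * hB oB true + K * hB oB false.
  rewrite -!KE -big_split/= [LHS]big_mkcond/=; apply: eq_bigr => eta _.
  rewrite phiE weightE; by case: (eta oB); case: ifP => _; rewrite /=; ring.
have -> : \sum_(eta in (root_plus T o N :&: plus_configs T o N)%SET)
    weight J beta eta = K * hB oB true.
  rewrite -!KE [LHS]big_mkcond/=; apply: eq_bigr => eta _.
  rewrite finset.in_setI rootE phiE weightE eqb_id.
  by case: (eta oB); case: (_ \in _) => /=; ring.
have HN b : hB oB b = H N.-1.+1 o b by rewrite /hB prednK// distxx subn0.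
have [h0 h1] := H_ratio o (M_ratio N.-1).
rewrite !HN h1; move: h0; set X := \sum_(y <- _) _; set h := H _ _ _ => h0.
have := expR_gt0 X; set e := expR X => e0.
by field; rewrite !gt_eqF ?addr_gt0 ?mulr_gt0.
Qed.

End Volume.

End IsingRecursion.

(** * The infinite volume limit *)

Section InfiniteVolume.
Context (R : realType) (V : choiceType) (T : tree V) (o : V) (J beta : R).
Hypothesis T_lf : locally_finite T.
Hypothesis bJ_gt0 : 0 < beta * J.

Local Notation kids := (kids T o).
Local Notation log_ratio := (log_ratio T o J beta).

Let A : R := expR (2 * (beta * J)).

Let A_gt1 : 1 < A.
Proof. by rewrite expR_gt1 mulr_gt0. Qed.

Lemma log_ratio_ge0 (n : nat) (w : V) : 0 <= log_ratio n w.
Proof.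
elim: n w => [|n IHn] w; first by rewrite mulr_ge0// ltW.
by apply: message_ge0 => //; apply: sumr_ge0 => y _; exact: IHn.
Qed.

(** The boundary value [2 * (beta * J)] is an upper bound of [message], so the first step decreases;
    monotonicity of [message] propagates this. *)
Lemma log_ratio_decr (n : nat) (w : V) : log_ratio n.+1 w <= log_ratio n w.
Proof.
elim: n w => [|n IHn] w.
  by have := message_le_ln A_gt1 (\sum_(y <- kids w) log_ratio 0 y); rewrite expRK.
by apply: message_homo => //; apply: ler_sum => y _; exact: IHn.
Qed.

Definition log_ratio_lim (w : V) : R := limn (log_ratio ^~ w).

Definition field_lim (v : V) : R := \sum_(y <- kids v) log_ratio_lim y.

Lemma cvg_log_ratio (w : V) : log_ratio ^~ w @ \oo --> log_ratio_lim w.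
Proof.
apply: nonincreasing_is_cvgn; last first.
  by exists 0 => _ [n _ <-]; exact: log_ratio_ge0.
by apply/nonincreasing_seqP => n; exact: log_ratio_decr.
Qed.

Lemma cvg_field (v : V) :
  (fun n => \sum_(y <- kids v) log_ratio n y) @ \oo --> field_lim v.
Proof.
rewrite /field_lim; elim: (enum_fset (kids v)) => [|y s IHs].
  rewrite big_nil; under eq_fun do rewrite big_nil; exact: cvg_cst.
rewrite big_cons; under eq_fun do rewrite big_cons.
by apply: cvgD => //; exact: cvg_log_ratio.
Qed.

Lemma log_ratio_lim_ge0 (w : V) : 0 <= log_ratio_lim w.
Proof.
apply: limr_ge; first exact: cvgP (@cvg_log_ratio w).
by apply: nearW => n; exact: log_ratio_ge0.
Qed.

Lemma field_lim_ge0 (v : V) : 0 <= field_lim v.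
Proof. by apply: sumr_ge0 => y _; exact: log_ratio_lim_ge0. Qed.

Lemma field_lim_ge (v : V) (x : R) :
  (forall n, x <= \sum_(y <- kids v) log_ratio n y) -> x <= field_lim v.
Proof.
move=> le_x; rewrite -(cvg_lim _ (@cvg_field v))//.
by apply: limr_ge; [exact: cvgP (@cvg_field v)|exact: nearW].
Qed.

Lemma log_ratio_limE (w : V) : log_ratio_lim w = message A (field_lim w).
Proof.
have c1 : (fun n => log_ratio n.+1 w) @ \oo --> log_ratio_lim w.
  by rewrite (cvg_shiftS (log_ratio ^~ w)); exact: cvg_log_ratio.
have c2 : (fun n => log_ratio n.+1 w) @ \oo --> message A (field_lim w).
  apply: continuous_cvg; last exact: cvg_field.
  exact: continuous_message.
by rewrite -(cvg_lim _ c1)// -(cvg_lim _ c2).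
Qed.

Lemma phase_transition_field : phase_transition_plus T o J beta <-> 0 < field_lim o.
Proof.
have e0 x := expR_gt0 (x : R).
have c1 : (fun N => plus_measure J beta (root_plus T o N.+1)) @ \oo -->
    1 - (1 + expR (field_lim o))^-1.
  under eq_fun do rewrite root_plusE//.
  apply: cvgB; first exact: cvg_cst.
  apply: cvgV; first by rewrite gt_eqF// addr_gt0.
  apply: cvgD; first exact: cvg_cst.
  by apply: continuous_cvg; [exact: continuous_expR|exact: cvg_field].
rewrite /phase_transition_plus.
move: c1; rewrite (cvg_shiftS (fun N => plus_measure J beta (root_plus T o N))).
move=> /cvg_lim ->//.
have half : 1 / 2 = 1 - 2^-1 :> R by field.
by rewrite half ltrD2l ltrN2 ltf_pV2 ?posrE ?addr_gt0// ltrD2l expR_gt1.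
Qed.

End InfiniteVolume.

(** * Flows of finite energy *)

Lemma nneseries_leP (R : realType) (f : nat -> R) (k : nat) (B : R) :
  (forall n, 0 <= f n) ->
  (\sum_(k <= n <oo) (f n)%:E <= B%:E)%E <->
  (forall n, \sum_(k <= i < n) f i <= B).
Proof.
move=> f0; split=> [le_B n|le_B].
  rewrite -lee_fin -sumEFin; apply: le_trans le_B.
  by apply: nneseries_lim_ge => i _; rewrite lee_fin.
apply: lime_le; first by apply: is_cvg_nneseries => i _ _; rewrite lee_fin.
by apply: nearW => n; rewrite sumEFin lee_fin.
Qed.

Section Energy.
Context (R : realType) (V : choiceType) (T : tree V) (o : V) (theta : R).
Hypothesis T_lf : locally_finite T.
Hypothesis T_inf : infinite_set [set: V].
Hypothesis T_nl : forall v : V, v != o -> ~ leaf T v.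
Hypothesis theta_gt0 : 0 < theta.
Implicit Types mu : V -> V -> R.

Local Notation depth := (dist T o).
Local Notation kids := (kids T o).
Local Notation up := (up T o).

(** Flow times resistance on the edge above [w]. In these units conservation carries a factor
    [theta], like the linear part of [message]. *)
Definition scaled mu (w : V) : R := mu (up w) w * theta ^- depth w.

(* The sum in [path_potential], restricted to the edges between [o] and [v]. *)
Definition energy mu (v : V) : R :=
  \sum_(i < depth v) scaled mu (iter i up v) ^+ 2.

Lemma energy_root mu : energy mu o = 0.
Proof. by rewrite /energy distxx big_ord0. Qed.

Lemma energy_child mu (v w : V) : parent T o v w ->
  energy mu w = scaled mu w ^+ 2 + energy mu v.
Proof.
move=> vw; rewrite /energy (dist_parent vw) big_ord_recl /=; congr (_ + _).
by apply: eq_bigr => i _; rewrite add0n -iterS iterSr (up_parent vw).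
Qed.

Lemma energy_ge0 mu (v : V) : 0 <= energy mu v.
Proof. by apply: sumr_ge0 => i _; exact: sqr_ge0. Qed.

Section Flow.
Context (mu : V -> V -> R).
Hypothesis mu_flow : flow T o mu.

Lemma scaled_ge0 (w : V) : w != o -> 0 <= scaled mu w.
Proof.
move=> wo; rewrite mulr_ge0 ?invr_ge0 ?exprn_ge0 ?(ltW theta_gt0)//.
by case: mu_flow => + _; apply; exact: parent_up.
Qed.

Let sum_scaled (v : V) :
  \sum_(y <- kids v) theta * scaled mu y =
  (\sum_(y <- kids v) mu v y) * theta ^- depth v.
Proof.
rewrite mulr_suml !big_seq; apply: eq_bigr => y; rewrite in_kids// => vy.
rewrite /scaled (up_parent vy) (dist_parent vy) exprS invfM.
by field; rewrite gt_eqF ?exprn_gt0// gt_eqF.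
Qed.

Lemma sum_scaled_root : \sum_(y <- kids o) theta * scaled mu y = strength T o mu.
Proof. by rewrite sum_scaled distxx expr0 invr1 mulr1 /strength sum_children. Qed.

Lemma sum_scaled_kids (w : V) : w != o ->
  \sum_(y <- kids w) theta * scaled mu y = scaled mu w.
Proof.
move=> wo; rewrite sum_scaled /scaled; congr (_ * _).
rewrite -sum_children//; apply/esym; case: mu_flow => _; apply.
  exact: parent_up.
exact: T_nl.
Qed.

Let res (_ w : V) : R := theta ^- depth w.

Lemma path_potentialE (y : nat -> V) : boundary T o y ->
  path_potential res (3 - 1) mu y =
  (\sum_(0 <= n <oo) (scaled mu (y n.+1) ^+ 2)%:E)%E.
Proof.
move=> [_ yP]; apply: eq_eseriesr => n _; congr (_%:E).
have -> : 3 - 1 = 2%:R :> R by ring.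
have e : scaled mu (y n.+1) = mu (y n) (y n.+1) * res (y n) (y n.+1).
  by rewrite /scaled (up_parent (yP n)).
by rewrite powR_mulrn -e// scaled_ge0// (parent_neq (yP n)).
Qed.

Lemma energy_boundary (y : nat -> V) (n : nat) : boundary T o y ->
  \sum_(0 <= i < n) scaled mu (y i.+1) ^+ 2 = energy mu (y n).
Proof.
move=> [y0 yP]; elim: n => [|n IHn]; first by rewrite big_nil y0 energy_root.
by rewrite big_nat_recr//= IHn addrC (energy_child _ (yP n)).
Qed.

Lemma energy_le_potential (v : V) :
  ((energy mu v)%:E <= potential T o res (3 - 1) mu)%E.
Proof.
have [y yb yP] := boundary_through T_inf T_nl v.
apply: (@le_trans _ _ (path_potential res (3 - 1) mu y)); last first.
  by apply: ereal_sup_ubound; exists y.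
have := yP 0%N isT; rewrite subn0 /= => yv.
rewrite path_potentialE// -[in leLHS]yv -energy_boundary// -sumEFin.
by apply: nneseries_lim_ge => i _; rewrite lee_fin sqr_ge0.
Qed.

(** The energies of the vertices of an infinite path are the partial sums of its potential, and
    every vertex lies on such a path. *)
Lemma potential_leP (B : R) :
  (potential T o res (3 - 1) mu <= B%:E)%E <-> forall v, energy mu v <= B.
Proof.
split=> [le_B v|le_B].
  by rewrite -lee_fin; apply: le_trans le_B; exact: energy_le_potential.
apply: ge_ereal_sup => _ [y yb <-]; rewrite path_potentialE//.
apply/nneseries_leP => [n|n]; first exact: sqr_ge0.
by rewrite energy_boundary.
Qed.

End Flow.

(** The potential is homogeneous of degree 2, so a flow whose potential is finite and positive can
    be normalized to potential 1. *)
Lemma cap_gt0P :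
  (0 < cap T o 3 (fun _ w : V => theta ^- depth w))%E <->
  exists mu, [/\ flow T o mu, 0 < strength T o mu &
    exists B, forall v, energy mu v <= B].
Proof.
set res := fun _ _ => _; rewrite /cap; set S := [set _ | _ in _]; split.
  case: eqP => [_|_]; first by rewrite ltxx.
  move=> /ereal_sup_gt[_ [mu [mu_flow mu1] <-]]; rewrite lte_fin => mu0.
  exists mu; split => //; exists 1; apply/potential_leP => //.
  by rewrite mu1.
move=> [mu [mu_flow mu0 [B le_B]]].
have le_pB : (potential T o res (3 - 1) mu <= B%:E)%E by apply/potential_leP.
have ge_p v : ((energy mu v)%:E <= potential T o res (3 - 1) mu)%E.
  exact: energy_le_potential.
have [P potP] : exists P, potential T o res (3 - 1) mu = P%:E.
  exists (fine (potential T o res (3 - 1) mu)); rewrite fineK//.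
  apply: (@fin_real _ _); rewrite (le_lt_trans le_pB (ltry _)) andbT.
  exact: lt_le_trans (ltNyr _) (ge_p o).
(* If [P <= 0], the energy at every child of the root vanishes, and hence so does the strength. *)
have P0 : 0 < P.
  rewrite ltNge; apply/negP => P0; move: mu0; apply/negP; rewrite -leNgt.
  rewrite -sum_scaled_root// big_seq big1// => y; rewrite in_kids// => oy.
  have := ge_p y; rewrite potP lee_fin (energy_child _ oy) energy_root addr0.
  move=> /le_trans/(_ P0) sy0; apply/eqP; rewrite mulf_eq0 gt_eqF//=.
  by rewrite -sqrf_eq0 eq_le sy0 sqr_ge0.
pose c := (Num.sqrt P)^-1.
have c0 : 0 < c by rewrite invr_gt0 sqrtr_gt0.
pose nu v w := c * mu v w.
have nu_flow : flow T o nu.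
  case: mu_flow => mu_ge0 mu_sum; split=> [v w vw|v w vw wl].
    by rewrite mulr_ge0 ?mu_ge0// ltW.
  by rewrite /nu (mu_sum _ _ vw wl) !sum_children// mulr_sumr.
have strength_nu : strength T o nu = c * strength T o mu.
  by rewrite /strength !sum_children// mulr_sumr.
have nu1 : potential T o res (3 - 1) nu = 1%E.
  transitivity ((c ^+ 2)%:E * potential T o res (3 - 1) mu)%E.
    rewrite -ereal_sup_pZl ?exprn_gt0//; congr ereal_sup.
    rewrite image_comp; apply: eq_imagel => y yb /=.
    rewrite !path_potentialE// -nneseriesZl; last first.
      by move=> i _; rewrite lee_fin sqr_ge0.
    by apply: eq_eseriesr => i _; rewrite -EFinM -exprMn /scaled mulrA.
  rewrite potP -EFinM; congr (_%:E).
  by rewrite /c exprVn sqr_sqrtr ?(ltW P0)// mulVf// gt_eqF.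
have S_nu : S (strength T o nu)%:E by exists nu.
rewrite (_ : (S == set0) = false); last first.
  by apply/negP => /eqP S0; rewrite S0 in S_nu.
apply: lt_le_trans (ereal_sup_ubound S_nu).
by rewrite lte_fin strength_nu mulr_gt0.
Qed.

End Energy.

(** * Comparison of the Ising recursion with flows *)

Lemma tanhE (R : realType) (x : R) :
  tanh x = (expR (2 * x) - 1) / (expR (2 * x) + 1).
Proof.
rewrite /tanh expRM_natl expRN; have := expR_gt0 x; set e := expR x => e0.
by field; rewrite !gt_eqF ?addr_gt0 ?exprn_gt0 ?invr_gt0.
Qed.

Lemma tanh_gt0 (R : realType) (x : R) : 0 < x -> 0 < tanh x.
Proof.
move=> x0; have e1 : 1 < expR (2 * x) by rewrite expR_gt1 mulr_gt0.
by rewrite tanhE divr_gt0// ?subr_gt0// addr_gt0// (lt_trans _ e1).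
Qed.

Section Comparison.
Context (R : realType) (V : choiceType) (T : tree V) (o : V) (J beta : R).
Hypothesis T_lf : locally_finite T.
Hypothesis T_inf : infinite_set [set: V].
Hypothesis T_nl : forall v : V, v != o -> ~ leaf T v.
Hypothesis bJ_gt0 : 0 < beta * J.

Local Notation depth := (dist T o).
Local Notation kids := (kids T o).
Local Notation up := (up T o).
Local Notation log_ratio := (log_ratio T o J beta).
Local Notation log_ratio_lim := (log_ratio_lim T o J beta).
Local Notation field_lim := (field_lim T o J beta).

Let A : R := expR (2 * (beta * J)).

Let A_gt1 : 1 < A.
Proof. by rewrite expR_gt1 mulr_gt0. Qed.

Context (theta : R).
Hypothesis thetaE : theta = (A - 1) / (A + 1).

Let theta_gt0 : 0 < theta.
Proof.
by rewrite thetaE divr_gt0// ?subr_gt0// addr_gt0// (lt_trans _ A_gt1).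
Qed.

Lemma flow_log_ratio (mu : V -> V -> R) (B : R) :
  flow T o mu -> 0 < strength T o mu ->
  (forall v, energy T o theta mu v <= B) -> 0 < field_lim o.
Proof.
move=> mu_flow mu_gt0 le_B.
have [k k0 [k_leaf k_step]] := message_lower A_gt1.
rewrite -thetaE in k_leaf k_step.
have rk0 : 0 < Num.sqrt k by rewrite sqrtr_gt0.
have kA : theta / Num.sqrt k <= 2 * (beta * J) by rewrite -[leRHS]expRK.
(* [D v] dominates the energy still available below [v], and it decreases along
   an edge by exactly the quantity that [k_step] adds under the square root. *)
pose D v := B + 1 - energy T o theta mu v.
have D0 v : 0 < D v by rewrite /D subr_gt0 (le_lt_trans (le_B v))// ltrDl.
have kD0 v : 0 < Num.sqrt (k * D v) by rewrite sqrtr_gt0 mulr_gt0.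
have D_child v w : parent T o v w ->
    D v = D w + scaled T o theta mu w ^+ 2.
  by move=> vw; rewrite /D (energy_child _ _ vw); ring.
have lower n v w : parent T o v w ->
    theta * scaled T o theta mu w / Num.sqrt (k * D v) <= log_ratio n w.
  elim: n v w => [|n IHn] v w vw.
    (* At the boundary, [D v] is at least the square of the scaled flow, so the left-hand side is at
       most [theta / Num.sqrt k]. *)
    apply: le_trans kA; rewrite -mulrA ler_pM2l// ler_pdivrMr//.
    rewrite sqrtrM ?(ltW k0)// mulrA mulVf ?gt_eqF// mul1r.
    rewrite (le_trans (ler_norm _))// -sqrtr_sqr ler_wsqrtr// (D_child v w)//.
    by rewrite lerDr ltW.
  have wo := parent_neq vw.
  set m := scaled T o theta mu w.
  have m0 : 0 <= m by exact: scaled_ge0.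
  have le_x : m / Num.sqrt (k * D w) <= \sum_(y <- kids w) log_ratio n y.
    rewrite /m -(sum_scaled_kids T_lf T_nl theta_gt0 mu_flow wo) mulr_suml.
    rewrite !big_seq; apply: ler_sum => y; rewrite in_kids// => wy.
    exact: IHn.
  have z0 : 0 <= m / Num.sqrt (k * D w) by rewrite divr_ge0// ltW.
  apply: le_trans (message_homo A_gt1 le_x); apply: le_trans (k_step _ z0).
  (* The two sides agree: [k * D w * (1 + k * m^2 / (k * D w)) = k * (D w + m^2) = k * D v]. *)
  rewrite -mulrA ler_pM2l// -[leRHS]mulrA ler_wpM2l//.
  have kDw : 0 < k * D w by exact: mulr_gt0.
  have s0 : 0 < 1 + k * (m / Num.sqrt (k * D w)) ^+ 2.
    by rewrite ltr_pwDl// mulr_ge0 ?sqr_ge0// ltW.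
  rewrite -invfM -sqrtrM ?(ltW kDw)// lef_pV2 ?posrE ?sqrtr_gt0 ?mulr_gt0//.
  rewrite ler_wsqrtr// (D_child v w)// -/m expr_div_n sqr_sqrtr ?(ltW kDw)//.
  rewrite le_eqVlt; apply/orP; left; apply/eqP; field.
  by rewrite !gt_eqF.
apply: (@lt_le_trans _ _ (strength T o mu / Num.sqrt (k * D o))).
  by rewrite divr_gt0.
apply: field_lim_ge => // n.
rewrite -(sum_scaled_root o T_lf theta_gt0 mu) mulr_suml !big_seq.
by apply: ler_sum => y; rewrite in_kids// => oy; exact: lower.
Qed.

(* By [message_upper] the factor [damping w] is small when the field at [w] is
   large, which is what bounds the energy of [field_flow].  Where the field
   vanishes, [damping] is [0] because [0 / 0 = 0]. *)
Definition damping (w : V) : R := log_ratio_lim w / (theta * field_lim w).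

Definition damping_prod (v : V) : R := \prod_(i < depth v) damping (iter i up v).

(** For [v] the parent of [w], this equals [theta^(depth v) * damping_prod v * log_ratio_lim w]:
    what enters [v] is split in proportion to the messages of its children. *)
Definition field_flow (_ w : V) : R :=
  theta ^+ depth w * (damping_prod w * field_lim w).

Let damping_prod_child (v w : V) : parent T o v w ->
  damping_prod w = damping w * damping_prod v.
Proof.
move=> vw; rewrite /damping_prod (dist_parent vw) big_ord_recl /=; congr (_ * _).
by apply: eq_bigr => i _; rewrite add0n -iterS iterSr (up_parent vw).
Qed.

Let scaled_field_flow (w : V) :
  scaled T o theta field_flow w = damping_prod w * field_lim w.
Proof.
rewrite /scaled /field_flow mulrAC divff ?mul1r// gt_eqF//.
by rewrite exprn_gt0.
Qed.

Let damping_ge0 (w : V) : 0 <= damping w.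
Proof.
apply: divr_ge0; first exact: log_ratio_lim_ge0.
by apply: mulr_ge0; [exact: ltW|exact: field_lim_ge0].
Qed.

Let damping_field (w : V) : damping w * field_lim w = log_ratio_lim w / theta.
Proof.
rewrite /damping; have [x0|x0] := eqVneq (field_lim w) 0; last first.
  by field; rewrite x0 gt_eqF.
by rewrite x0 mulr0 log_ratio_limE// x0 message0 mul0r.
Qed.

Let sum_field_flow (v : V) : \sum_(y <- kids v) field_flow v y =
  theta ^+ depth v * (damping_prod v * field_lim v).
Proof.
transitivity (theta ^+ depth v *
  (damping_prod v * \sum_(y <- kids v) log_ratio_lim y)); last by [].
rewrite !mulr_sumr !big_seq; apply: eq_bigr => y; rewrite in_kids// => vy.
rewrite /field_flow (damping_prod_child vy) (dist_parent vy).
rewrite [damping y * _]mulrC -[_ * damping y * _]mulrA damping_field exprS.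
by field; rewrite gt_eqF.
Qed.

Lemma field_flow_flow : flow T o field_flow.
Proof.
split=> [v w _|v w vw _]; last by rewrite sum_children// sum_field_flow.
rewrite mulr_ge0 ?exprn_ge0 ?(ltW theta_gt0)// mulr_ge0//.
  by apply: prodr_ge0 => i _; exact: damping_ge0.
exact: field_lim_ge0.
Qed.

Lemma strength_field_flow : strength T o field_flow = field_lim o.
Proof.
rewrite /strength sum_children// sum_field_flow distxx /damping_prod distxx.
by rewrite big_ord0 !mul1r.
Qed.

Lemma energy_field_flow : exists B, forall v, energy T o theta field_flow v <= B.
Proof.
have [k k0 k_step] := message_upper A_gt1; rewrite -thetaE in k_step.
have damping_le w : damping w ^+ 2 * (1 + k * field_lim w ^+ 2) <= 1.
  have x0 : 0 <= field_lim w by exact: field_lim_ge0.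
  rewrite /damping log_ratio_limE//.
  have := k_step _ x0; set x := field_lim w in x0 *; set f := message _ _.
  have [->|xn0] := eqVneq x 0; first by rewrite mulr0 invr0 mulr0 expr0n /= mul0r.
  move=> fx; rewrite expr_div_n exprMn mulrAC ler_pdivrMr ?mul1r//.
  by rewrite mulr_gt0// exprn_gt0// lt0r xn0.
(* [k * energy] telescopes against the squares of [damping_prod]. *)
suff le_k v : k * energy T o theta field_flow v <= 1 - damping_prod v ^+ 2.
  exists k^-1 => v; rewrite -[leRHS]mul1r ler_pdivlMr// mulrC.
  by apply: le_trans (le_k v) _; rewrite gerBl sqr_ge0.
move: {2}(depth v) (erefl (depth v)) => n; elim: n v => [|n IHn] v.
  move=> /eqP; rewrite dist_eq0 => /eqP ->; rewrite energy_root /damping_prod.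
  by rewrite distxx big_ord0 mulr0 expr1n subrr.
move=> vn; have vo : v != o by rewrite -(dist_eq0 T) vn.
have pv := parent_up T vo.
have {}IHn : k * energy T o theta field_flow (up v) <=
    1 - damping_prod (up v) ^+ 2.
  by apply: IHn; apply/succn_inj; rewrite -vn [RHS](dist_up T vo).
rewrite (energy_child _ _ pv) scaled_field_flow (damping_prod_child pv).
have := ler_wpM2r (sqr_ge0 (damping_prod (up v))) (damping_le v).
set a := damping_prod _ in IHn *; set e := energy _ _ _ _ _ in IHn *.
set x := field_lim v; set q := damping v; lra.
Qed.

Lemma phase_transition_capacity : phase_transition_plus T o J beta <->
  (0 < cap T o 3 (fun _ w : V => theta ^- depth w))%E.
Proof.
rewrite phase_transition_field// cap_gt0P//; split=> [x0|].
  exists field_flow; split; first exact: field_flow_flow.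
    by rewrite strength_field_flow.
  exact: energy_field_flow.
by move=> [mu [mu_flow mu_gt0 [B le_B]]]; exact: flow_log_ratio le_B.
Qed.

End Comparison.

(** * Spherically symmetric trees *)

Section SphericallySymmetric.
Context (R : realType) (V : choiceType) (T : tree V) (o : V).
Hypothesis T_lf : locally_finite T.
Hypothesis T_inf : infinite_set [set: V].
Hypothesis T_nl : forall v : V, v != o -> ~ leaf T v.
Hypothesis T_sym : spherically_symmetric T o.

Local Notation depth := (dist T o).
Local Notation kids := (kids T o).
Local Notation up := (up T o).

Lemma level_size0 : level_size T o 0 = 1%N.
Proof.
rewrite /level_size (_ : level T o 0 = [set o]) ?fset_set1 ?cardfs1//.
apply/seteqP; split=> v /=; last by move->; rewrite /level/= distxx.
by rewrite /level/= => /eqP; rewrite dist_eq0 => /eqP.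
Qed.

Lemma level_size_gt0 (n : nat) : (0 < level_size T o n)%N.
Proof.
suff [v vn] : exists v, depth v = n.
  rewrite /level_size cardfs_gt0; apply/fset0Pn; exists v.
  by rewrite in_level// vn.
elim: n => [|n [v vn]]; first by exists o; rewrite distxx.
have [w vw] := kid_exists T_inf T_nl v.
by exists w; rewrite (dist_parent vw) vn.
Qed.

(** Double counting of the parent-child pairs between two consecutive levels; by symmetry any [v] of
    the upper level gives the common number of children. *)
Lemma level_sizeS (v : V) :
  level_size T o (depth v).+1 = (#|` kids v| * level_size T o (depth v))%N.
Proof.
set n := depth v; rewrite /level_size.
set L := fset_set (level T o n); set L' := fset_set (level T o n.+1).
transitivity (\sum_(w <- L') \sum_(u <- L | u == up w) 1)%N.
  rewrite -sum1_size !big_seq; apply: eq_bigr => w; rewrite in_level// => /eqP wn.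
  have wo : w != o by rewrite -(dist_eq0 T) wn.
  rewrite big_const_seq iter_addn_0 mul1n -/(count_mem (up w) L).
  rewrite count_uniq_mem ?fset_uniq// in_level//.
  by move: (dist_up T wo); rewrite wn => -[<-]; rewrite eqxx.
rewrite (exchange_big_dep predT)//=.
transitivity (\sum_(u <- L) #|` kids v|)%N; last first.
  by rewrite big_const_seq iter_addn_0 count_predT.
rewrite !big_seq; apply: eq_bigr => u; rewrite in_level// => /eqP un.
rewrite -(T_sym un) -[#|` _|]/(size (kids u)).
rewrite -sum1_size -big_filter; apply: perm_big; apply: uniq_perm.
- by rewrite filter_uniq// fset_uniq.
- exact: fset_uniq.
move=> w; rewrite mem_filter in_kids// in_level//.
apply/andP/parentP => [[/eqP uw /eqP wn]|[wo wu]].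
  by split=> //; rewrite -(dist_eq0 T) wn.
by rewrite wu eqxx (dist_up T wo) wu un eqxx.
Qed.

Lemma sum_kids_const (F : V -> R) (v : V) (c : R) :
  (forall y, parent T o v y -> F y = c) ->
  \sum_(y <- kids v) F y = (#|` kids v|)%:R * c.
Proof.
move=> Fc; rewrite (eq_big_seq (fun=> c)); last first.
  by move=> y; rewrite in_kids// => /Fc.
by rewrite big_const_seq iter_addr_0 count_predT mulr_natl.
Qed.

Lemma sum_kids_radial (F : V -> R) (v w : V) :
  (forall x y, depth x = depth y -> F x = F y) ->
  depth v = depth w -> \sum_(y <- kids v) F y = \sum_(y <- kids w) F y.
Proof.
move=> F_radial vw; have [y vy] := kid_exists T_inf T_nl v.
rewrite !(@sum_kids_const F _ (F y)).
- by congr (_%:R * _); exact: T_sym.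
- by move=> x wx; apply: F_radial; rewrite (dist_parent wx) (dist_parent vy) vw.
- by move=> x vx; apply: F_radial; rewrite (dist_parent vx) (dist_parent vy).
Qed.

Section Theta.
Context (theta : R).
Hypothesis theta_gt0 : 0 < theta.

Lemma radial_energy (mu : V -> V -> R) (s : R) :
  (forall w, w != o -> mu (up w) w * (level_size T o (depth w))%:R = s) ->
  forall v, energy T o theta mu v = s ^+ 2 *
    \sum_(1 <= n < (depth v).+1) theta ^- (2 * n) * (level_size T o n)%:R ^- 2.
Proof.
move=> mu_s v; move: {2}(depth v) (erefl (depth v)) => n.
elim: n v => [|n IHn] v vn.
  have /eqP -> : v == o by rewrite -(dist_eq0 T) vn.
  by rewrite energy_root distxx big_geq// mulr0.
have vo : v != o by rewrite -(dist_eq0 T) vn.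
have upn : depth (up v) = n by apply/succn_inj; rewrite -vn [RHS](dist_up T vo).
rewrite (energy_child _ _ (parent_up T vo)) IHn// upn vn [in RHS]big_nat_recr//=.
rewrite mulrDr addrC; congr (_ + _); rewrite /scaled -(mu_s _ vo) vn.
have l0 : (level_size T o n.+1)%:R != 0 :> R.
  by rewrite pnatr_eq0 -lt0n level_size_gt0.
rewrite mulnC exprM; have := gt_eqF (exprn_gt0 n.+1 theta_gt0).
set t := theta ^+ _ => t0; field.
by rewrite l0 t0.
Qed.

(** A radial flow is split equally among children, so conservation and [level_sizeS] keep the total
    through each level constant. *)
Lemma radial_flow_level (mu : V -> V -> R) : flow T o mu ->
  (forall x y, depth x = depth y -> x != o -> mu (up x) x = mu (up y) y) ->
  forall w, w != o ->
    mu (up w) w * (level_size T o (depth w))%:R = strength T o mu.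
Proof.
move=> mu_flow mu_radial w.
move: {2}(depth w) (erefl (depth w)) => n; elim: n w => [|n IHn] w wn wo.
  by move: wo; rewrite -(dist_eq0 T) wn.
have := dist_up T wo; set v := up w => wv.
have sum_v : \sum_(y <- kids v) mu v y = (#|` kids v|)%:R * mu v w.
  apply: sum_kids_const => y vy.
  rewrite -{1}(up_parent vy) -/v; apply: mu_radial.
    by rewrite (dist_parent vy) wv.
  exact: parent_neq vy.
rewrite wv level_sizeS natrM mulrA [mu v w * _]mulrC -sum_v.
have [vo|vo] := eqVneq v o.
  by rewrite vo distxx level_size0 mulr1 /strength sum_children.
rewrite -(IHn v)//; last by apply/succn_inj; rewrite -wn wv.
congr (_ * _); rewrite -sum_children//; apply/esym.
by case: mu_flow => _; apply; [exact: parent_up|exact: T_nl].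
Qed.

Definition uniform_flow (_ w : V) : R := (level_size T o (depth w))%:R^-1.

Lemma uniform_flowE (w : V) :
  uniform_flow (up w) w * (level_size T o (depth w))%:R = 1.
Proof. by rewrite mulVf// pnatr_eq0 -lt0n level_size_gt0. Qed.

Let sum_uniform_flow (v : V) :
  \sum_(y <- kids v) uniform_flow v y = (level_size T o (depth v))%:R^-1.
Proof.
rewrite (@sum_kids_const _ _ (level_size T o (depth v).+1)%:R^-1); last first.
  by move=> y vy; rewrite /uniform_flow (dist_parent vy).
rewrite level_sizeS natrM invfM mulrA divff ?mul1r//.
rewrite pnatr_eq0 cardfs_eq0; have [y vy] := kid_exists T_inf T_nl v.
by apply/fset0Pn; exists y; rewrite in_kids.
Qed.

Lemma uniform_flow_flow : flow T o uniform_flow.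
Proof.
split=> [v w _|v w _ _]; first by rewrite invr_ge0.
by rewrite sum_children// sum_uniform_flow.
Qed.

Lemma strength_uniform_flow : strength T o uniform_flow = 1.
Proof.
by rewrite /strength sum_children// sum_uniform_flow distxx level_size0 invr1.
Qed.

(** By [radial_energy] the energies are [s^2] times the partial sums of the series, and every depth
    occurs. It is applied to [field_flow] with [s] the field at the root, and to [uniform_flow] with
    [s = 1]. *)
Lemma series_energy (mu : V -> V -> R) (s : R) : s != 0 ->
  (forall w, w != o -> mu (up w) w * (level_size T o (depth w))%:R = s) ->
  (\sum_(1 <= n <oo)
     (theta ^- (2 * n) * (level_size T o n)%:R ^- 2)%:E < +oo)%E <->
  exists B, forall v, energy T o theta mu v <= B.
Proof.
move=> s0 mu_s; set t := fun n => theta ^- (2 * n) * (level_size T o n)%:R ^- 2.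
have t_ge0 n : 0 <= t n.
  by rewrite mulr_ge0// invr_ge0 ?exprn_ge0// ltW.
have sum_ge0 : (0 <= \sum_(1 <= n <oo) (t n)%:E)%E.
  by apply: nneseries_ge0 => n _ _; rewrite lee_fin.
have s2 : 0 < s ^+ 2 by rewrite lt0r sqrf_eq0 s0 sqr_ge0.
split=> [fin_t|[B le_B]].
  have [B le_B] : exists B, (\sum_(1 <= n <oo) (t n)%:E <= B%:E)%E.
    exists (fine (\sum_(1 <= n <oo) (t n)%:E)%E); rewrite fineK//.
    by rewrite ge0_fin_numE.
  exists (s ^+ 2 * B) => v; rewrite (radial_energy mu_s) ler_pM2l//.
  exact: (iffLR (nneseries_leP _ _ t_ge0)).
apply: (@le_lt_trans _ _ (B / s ^+ 2)%:E); last exact: ltry.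
apply/nneseries_leP => // -[|n].
  by rewrite big_geq// divr_ge0 ?(ltW s2)// (le_trans _ (le_B o))// energy_ge0.
have [v <-] : exists v, depth v = n.
  have /fset0Pn[v] : fset_set (level T o n) != fset0.
    by rewrite -cardfs_gt0 level_size_gt0.
  by rewrite in_level// => /eqP; exists v.
by rewrite ler_pdivlMr// mulrC -(radial_energy mu_s).
Qed.

End Theta.

Section Field.
Context (J beta : R).
Hypothesis bJ_gt0 : 0 < beta * J.

Lemma log_ratio_lim_radial (v w : V) :
  depth v = depth w -> log_ratio_lim T o J beta v = log_ratio_lim T o J beta w.
Proof.
move=> vw; congr (limn _); apply/funext => n.
elim: n v w vw => [v w _|n IHn v w vw]; first by [].
congr (message _ _); exact: sum_kids_radial.
Qed.

Lemma field_lim_radial (v w : V) :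
  depth v = depth w -> field_lim T o J beta v = field_lim T o J beta w.
Proof. by apply: sum_kids_radial; exact: log_ratio_lim_radial. Qed.

Lemma field_flow_radial (theta : R) (v w : V) : depth v = depth w ->
  field_flow T o J beta theta (up v) v = field_flow T o J beta theta (up w) w.
Proof.
move=> vw; rewrite /field_flow vw (field_lim_radial vw) /damping_prod vw.
congr (_ * (_ * _)); apply: eq_bigr => i _; rewrite /damping.
have ivw : depth (iter i up v) = depth (iter i up w).
  have iw : (i <= depth w)%N by exact: ltnW.
  by rewrite !dist_iter_up ?vw.
by rewrite (log_ratio_lim_radial ivw) (field_lim_radial ivw).
Qed.

End Field.

End SphericallySymmetric.

Theorem corollary2p4 (R : realType) (V : choiceType) (T : tree V) (o : V)
    (V_infinite : infinite_set [set: V])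
    (T_locally_finite : locally_finite T)
    (T_no_leaves : forall v : V, v != o -> ~ leaf T v)
    (J beta : R) (J_gt0 : 0 < J) (beta_gt0 : 0 < beta) :
  let theta : R := tanh (beta * J) in
  (phase_transition_plus T o J beta <->
     (0 < cap T o 3 (fun _ w : V => theta ^- dist T o w))%E) /\
  (spherically_symmetric T o ->
     (phase_transition_plus T o J beta <->
        (\sum_(1 <= n <oo)
           (theta ^- (2 * n) * (level_size T o n)%:R ^- 2)%:E < +oo)%E)).
Proof.
move=> theta; have bJ_gt0 : 0 < beta * J by rewrite mulr_gt0.
have theta_gt0 : 0 < theta by exact: tanh_gt0.
have thetaE := tanhE (beta * J); rewrite -/theta in thetaE.
split=> [|T_sym]; first exact: phase_transition_capacity.
have series mu s := @series_energy R V T o T_locally_finite V_infinite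
  T_no_leaves theta theta_gt0 mu s.
rewrite phase_transition_field//; split=> [x0|fin_t].
  apply/(series (field_flow T o J beta theta) (field_lim T o J beta o)).
  - by rewrite gt_eqF.
  - move=> w wo; rewrite -(strength_field_flow o T_locally_finite bJ_gt0 thetaE).
    apply: radial_flow_level => //; first exact: field_flow_flow.
    by move=> x y xy _; exact: field_flow_radial.
  - exact: energy_field_flow.
have [B le_B] : exists B, forall v,
    energy T o theta (uniform_flow R T o) v <= B.
  apply/(series _ 1) => // w _; exact: uniform_flowE.
apply: (flow_log_ratio T_locally_finite T_no_leaves bJ_gt0 thetaE _ _ le_B).
  exact: uniform_flow_flow.
by rewrite strength_uniform_flow.
Qed.
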